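(* For every $\kappa>1$, $\ln2\le S_{\max}(\kappa)<\ln3$.
   Context: For $\kappa>1$, $S_{\max}(\kappa)$ denotes the maximum of the von Neumann entropy $-\sum_{i=1}^3\lambda_i\ln\lambda_i$ over all triples $\lambda_1\ge\lambda_2\ge\lambda_3>0$ with $\lambda_1+\lambda_2+\lambda_3=1$ and $\lambda_1/\lambda_3=\kappa$ (the spectra of invertible $3\times3$ density matrices with condition number $\kappa$). *)

(* Defs.v *)
From HB Require Import structures.
From mathcomp Require Import all_boot all_order all_algebra.
From mathcomp Require Import all_classical all_reals all_analysis.
From mathcomp Require Import ring lra.

Set Implicit Arguments.
Unset Strict Implicit.
Unset Printing Implicit Defensive.

Import Order.TTheory GRing.Theory Num.Theory.
Import numFieldNormedType.Exports.

Local Open Scope classical_set_scope.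
Local Open Scope ring_scope.

(* lambda_1, lambda_2, lambda_3 are lam 0, lam 1, lam 2. *)
Definition entropy {R : realType} (lam : 'I_3 -> R) : R :=
  - \sum_(i < 3) lam i * ln (lam i).

Definition spectra {R : realType} (kappa : R) : set ('I_3 -> R) :=
  [set lam | [/\ lam 1 <= lam 0, lam 2 <= lam 1, 0 < lam 2,
                 \sum_(i < 3) lam i = 1 & lam 0 / lam 2 = kappa]].

(* Written as a supremum to make it a total function of kappa; for 1 < kappa it
   is an attained maximum, by Smax_attained and Smax_ub. *)
Definition Smax {R : realType} (kappa : R) : R :=
  sup (entropy @` spectra kappa).

(* The only element of spectra kappa with smallest entry t, if there is one. *)
Definition lam_of {R : realType} (kappa t : R) : 'I_3 -> R :=
  fun i => if i == 0 then kappa * t else if i == 1 then 1 - (kappa + 1) * t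
           else t.

Lemma sum3E {R : realType} (f : 'I_3 -> R) :
  \sum_(i < 3) f i = f 0 + f 1 + f 2.
Proof.
rewrite !big_ord_recr big_ord0 /= add0r.
by congr (f _ + f _ + f _); exact/val_inj.
Qed.

Lemma spectra_lam_of {R : realType} (kappa : R) : 1 < kappa ->
  spectra kappa =
  lam_of kappa @` `[(2 * kappa + 1)^-1, (kappa + 2)^-1]%classic.
Proof.
move=> k1.
have p1 : 0 < 2 * kappa + 1 by lra.
have p2 : 0 < kappa + 2 by lra.
apply/seteqP; split=> [lam [l10 l21 l2 + lk]|_ [t /= + <-]].
- rewrite sum3E => s1.
  have lE : lam 0 = kappa * lam 2 by rewrite -lk divfK ?gt_eqF.
  exists (lam 2).
    rewrite /= in_itv /= -(div1r (2 * kappa + 1)) -(div1r (kappa + 2)).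
    rewrite ler_pdivrMr ?ler_pdivlMr //.
    by apply/andP; split; lra.
  apply/funext => i; rewrite /lam_of.
  case: eqP => [->|i0]; first by rewrite lE.
  case: eqP => [->|i1]; first by lra.
  congr lam; apply/val_inj.
  case: i i0 i1 => -[|[|[|//]]] /= il i0 i1 //.
    by case: i0; exact/val_inj.
  by case: i1; exact/val_inj.
- rewrite in_itv /= -(div1r (2 * kappa + 1)) -(div1r (kappa + 2)).
  rewrite ler_pdivrMr ?ler_pdivlMr // => /andP[a b].
  have t0 : 0 < t by rewrite -(pmulr_lgt0 _ p1); lra.
  rewrite /spectra /= sum3E /lam_of /=; split; [lra|lra|lra|ring|].
  by rewrite mulfK ?gt_eqF.
Qed.

Lemma entropy_max {R : realType} (kappa : R) : 1 < kappa ->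
  exists2 lam, spectra kappa lam &
    forall lam', spectra kappa lam' -> entropy lam' <= entropy lam.
Proof.
move=> k1; rewrite spectra_lam_of//.
have p1 : 0 < 2 * kappa + 1 by lra.
have p2 : 0 < kappa + 2 by lra.
have le_ends : (2 * kappa + 1)^-1 <= (kappa + 2)^-1.
  by rewrite lef_pV2 ?posrE//; lra.
have [|c cI cmax] := @EVT_max R (fun t => entropy (lam_of kappa t)) _ _ le_ends.
  apply: continuous_in_subspaceT => t; rewrite inE /= => tI.
  have : spectra kappa (lam_of kappa t).
    by rewrite spectra_lam_of//; exists t.
  case; rewrite /lam_of /= => _ l21 t0 _ _.
  rewrite /entropy; under eq_fun do rewrite sum3E /lam_of /=.
  have cln (f : R -> R) : 0 < f t -> {for t, continuous f} ->
      {for t, continuous (fun x => f x * ln (f x))}.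
    move=> ft cf; apply: cvgM => //.
    by apply: (continuous_comp cf); exact: continuous_ln.
  have cm (a : R) : {for t, continuous (fun x : R => a * x)}.
    by apply: cvgM; [exact: cvg_cst|exact: cvg_id].
  apply: cvgN; apply: cvgD; first apply: cvgD.
  - by apply: (cln (fun x => kappa * x)); [apply: mulr_gt0 => //; lra|exact: cm].
  - apply: (cln (fun x => 1 - (kappa + 1) * x)); first by lra.
    by apply: cvgB; [exact: cvg_cst|exact: cm].
  - by apply: (cln id); [|exact: cvg_id].
exists (lam_of kappa c); first by exists c.
by move=> _ [t tI <-]; exact: cmax.
Qed.

Lemma Smax_ub {R : realType} (kappa : R) (lam : 'I_3 -> R) : 1 < kappa ->
  spectra kappa lam -> entropy lam <= Smax kappa.
Proof.
move=> k1 sl; have [m sm mmax] := entropy_max k1.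
apply: ub_le_sup; last by exists lam.
by exists (entropy m) => _ [l sl' <-]; exact: mmax.
Qed.

Lemma Smax_attained {R : realType} (kappa : R) : 1 < kappa ->
  exists2 lam, spectra kappa lam & entropy lam = Smax kappa.
Proof.
move=> k1; have [m sm mmax] := entropy_max k1.
exists m => //; apply/eqP; rewrite eq_le Smax_ub//=.
apply: ge_sup; first by exists (entropy m), m.
by move=> _ [l sl <-]; exact: mmax.
Qed.

(* Main.v *)
(** Every spectrum with all entries at most 1/2 has entropy at least [ln 2],
    since then each [- ln lam_i] is at least [ln 2]; the spectrum
    [(kappa, kappa, 1) / (2 kappa + 1)] is of this kind.  Gibbs' inequality
    against the uniform spectrum gives the upper bound, strictly since
    [lam_0 <> lam_2]. *)
Require Import Defs.
From mathcomp Require Import all_boot all_order all_algebra.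
From mathcomp Require Import all_classical all_reals all_analysis.
From mathcomp Require Import ring lra.

Import Order.TTheory GRing.Theory Num.Theory.

Local Open Scope ring_scope.

Lemma ln2_le_entropy (R : realType) (lam : 'I_3 -> R) :
  (forall i, 0 < lam i <= 2^-1) -> \sum_(i < 3) lam i = 1 ->
  ln 2 <= entropy lam.
Proof.
(* As the weights [lam i] sum to 1, [ln 2] is spread over them and the sums are compared
   termwise. *)
move=> lamP sum1; rewrite /entropy -sumrN -[ln 2]mul1r -[X in X * _]sum1 mulr_suml.
apply: ler_sum => i _; have /andP[lam_gt0 lam_le] := lamP i.
rewrite -mulrN ler_pM2l// lerNr -lnV ?posrE//.
by rewrite ler_ln ?posrE ?invr_gt0// -[2]invrK lef_pV2 ?posrE ?invr_gt0.
Qed.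

(** Instance [y = ln x] of the strict bound [1 + y < expR y] for nonzero [y]. *)
Lemma ln_lt_subr1 (R : realType) (x : R) : 0 < x -> x != 1 -> ln x < x - 1.
Proof.
move=> x_gt0 x_neq1; have lnx_neq0 : ln x != 0 by rewrite ln_eq0.
by have := expR_gt1Dx lnx_neq0; rewrite lnK ?posrE// => ?; lra.
Qed.

Lemma entropy_lt_ln3 (R : realType) (lam : 'I_3 -> R) (j : 'I_3) :
  (forall i, 0 < lam i) -> \sum_(i < 3) lam i = 1 -> lam j != 3^-1 ->
  entropy lam < ln 3.
Proof.
move=> lam_gt0 sum1 lamj.
(* Ratio of the uniform weight to [lam i]. Weighted by [lam], the [ln (u i)] sum to
   [entropy lam - ln 3] and the [u i - 1] to 0. *)
pose u i := (3 * lam i)^-1.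
have u_gt0 i : 0 < u i by rewrite invr_gt0 mulr_gt0.
have uj : u j != 1.
  rewrite invr_eq1; apply: contra lamj => /eqP lamj3.
  by apply/eqP; lra.
have lamB i : lam i * (u i - 1) = 3^-1 - lam i.
  by rewrite /u; field; rewrite gt_eqF.
have lamln i : lam i * ln (u i) = - (lam i * ln (lam i)) - lam i * ln 3.
  by rewrite lnV ?posrE ?mulr_gt0// lnM ?posrE//; ring.
have : \sum_(i < 3) lam i * ln (u i) < \sum_(i < 3) lam i * (u i - 1).
  (* One strict term, at [j], suffices. *)
  rewrite (bigD1 j)//= [ltRHS](bigD1 j)//= ltr_leD//.
    by rewrite ltr_pM2l// ln_lt_subr1.
  by apply: ler_sum => i _; rewrite ler_pM2l// -{1}[u i](subrKC 1) le_ln1Dx// ltrBDl addrN.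
have -> : \sum_(i < 3) lam i * (u i - 1) = 0.
  by under eq_bigr do rewrite lamB; rewrite sumrB sum1 sum3E; lra.
under eq_bigr do rewrite lamln.
by rewrite sumrB -mulr_suml sum1 mul1r sumrN subr_lt0.
Qed.

Lemma spectra_gt0 (R : realType) (kappa : R) (lam : 'I_3 -> R) :
  spectra kappa lam -> forall i, 0 < lam i.
Proof.
move=> [l10 l21 l2_gt0 _ _] i.
have : [|| i == 0, i == 1 | i == 2] by case: i => -[|[|[|]]].
by case/or3P => /eqP->; lra.
Qed.

Theorem corollary5p16 (R : realType) (kappa : R) (hkappa : 1 < kappa) :
  ln 2 <= Smax kappa < ln 3.
Proof.
have p1 : 0 < 2 * kappa + 1 by lra.
apply/andP; split.
  (* The least admissible smallest entry; there the middle entry equals [kappa * t]. *)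
  pose t := (2 * kappa + 1)^-1.
  have st : spectra kappa (lam_of kappa t).
    rewrite spectra_lam_of//; exists t => //=.
    by rewrite in_itv /= lexx lef_pV2 ?posrE; lra.
  apply: le_trans (Smax_ub hkappa st).
  have tE : (2 * kappa + 1) * t = 1 by rewrite mulfV ?gt_eqF.
  have t_gt0 : 0 < t by rewrite invr_gt0.
  have kt_gt0 : 0 < kappa * t by rewrite mulr_gt0//; lra.
  have [_ _ _ sum1 _] := st.
  apply: ln2_le_entropy => // i; rewrite /lam_of.
  have t_lt : t < kappa * t by rewrite ltr_pMl.
  (* By [tE], [2 * (kappa * t) = 1 - t < 1], which bounds the largest entry by 1/2. *)
  by case: ifP => _; [|case: ifP => _]; apply/andP; split; lra.
have [lam slam <-] := Smax_attained hkappa.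
have [l10 l21 l2_gt0 sum1 lk] := slam.
apply: (entropy_lt_ln3 _ lam 2) => //; first exact: spectra_gt0 slam.
(* If the smallest entry were 1/3, sum 1 would make all entries equal, so [kappa = 1]. *)
apply/eqP => lam2; move: sum1; rewrite sum3E => sum1.
have lam02 : lam 0 = lam 2 by lra.
by move: hkappa; rewrite -lk lam02 mulfV ?gt_eqF// ltxx.
Qed.
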